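(* Let $X$ be a Bishop topological group with Bishop topology $F$, and let $H$ be an extensional subset of $X$ (i.e. closed under the given equality $=_X$). Define the normalizer and the center of $H$ in $X$ by $$\mathrm{Normal}_X(H) := \{x \in X \mid \forall_{v \in H}\,(v + x - v \in H)\},$$ $$\mathrm{Center}_X(H) := \{x \in X \mid \forall_{v \in H}\,(x + v - x - v = 0)\}.$$ (i) If $H$ is closed, then $\mathrm{Normal}_X(H)$ is closed. (ii) If $F$ is separating, then $\mathrm{Center}_X(H)$ is closed.
   Context: The setting is Bishop-style constructive mathematics (BISH: intuitionistic logic, every set $X$ carries a given equality $=_X$, no countable choice). $\mathbb{F}(X)$ is the set of functions $X \to \mathbb{R}$ with pointwise equality. $\mathrm{Bic}(\mathbb{R})$ is the set of functions $\phi : \mathbb{R} \to \mathbb{R}$ that are uniformly continuous on every interval $[-n,n]$, $n \geq 1$. A Bishop space is a pair $(X,F)$, where $X$ is an inhabited set and $F \subseteq \mathbb{F}(X)$ is extensional (if $f \in F$ and $g$ is pointwise equal to $f$, then $g \in F$) such that: (BS1) all constant functions are in $F$; (BS2) $f, g \in F$ implies $f+g \in F$; (BS3) $f \in F$ and $\phi \in \mathrm{Bic}(\mathbb{R})$ imply $\phi \circ f \in F$; (BS4) if $f \in \mathbb{F}(X)$ and for every $\varepsilon > 0$ there is $g \in F$ with $|g(x) - f(x)| \leq \varepsilon$ for all $x \in X$, then $f \in F$. Then $F$ is called a Bishop topology on $X$. A Bishop morphism from $(X,F)$ to $(Y,G)$ is a function $h : X \to Y$ with $g \circ h \in F$ for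 every $g \in G$. The product topology $F \times G$ on $X \times Y$ is the least Bishop topology (inductively generated by the closure conditions (BS1)-(BS4) and extensionality) containing all $f \circ \pi_1$, $f \in F$, and all $g \circ \pi_2$, $g \in G$, where $\pi_1, \pi_2$ are the projections. A Bishop topological group is a (not necessarily abelian, additively written) group $(X,+,0,-)$ with a Bishop topology $F$ on $X$ such that $+ : X \times X \to X$ is a Bishop morphism from $(X \times X, F \times F)$ to $(X,F)$ and $- : X \to X$ is a Bishop morphism from $(X,F)$ to $(X,F)$. For $C \subseteq X$, the closure $\overline{C}$ consists of all $x \in X$ such that for every $f \in F$, if $f(x) > 0$ then there is $c \in C$ with $f(c) > 0$; $C$ is closed if $\overline{C} \subseteq C$. $F$ is separating (separates the points of $X$) if for all $x, y \in X$: if $f(x) = f(y)$ for every $f \in F$, then $x =_X y$. *)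

(* Defs.v *)
From Stdlib Require Import QArith Setoid Morphisms.
From Stdlib Require Import ConstructiveReals ConstructiveAbs.

Local Open Scope ConstructiveReals.

Set Implicit Arguments.
Unset Strict Implicit.

(* Sets in the sense of Bishop are setoids, and functions between them respect
   the given equalities.  The real numbers are an arbitrary instance [R] of the
   interface [ConstructiveReals]; their equality is [CReq R].  The order [CRlt]
   of that interface lives in [Set], so strict inequalities are stated with its
   (logically equivalent) propositional version [CRltProp]. *)

Record bset : Type := Bset {
  carrier :> Type;
  beq : carrier -> carrier -> Prop;
  beq_equiv :: Equivalence beq
}.

Declare Scope bset_scope.
Delimit Scope bset_scope with bset.
Notation "x =b y" := (beq x y) (at level 70, no associativity) : bset_scope.
Local Open Scope bset_scope.

Record bfun (X Y : bset) : Type := Bfun {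
  bap :> X -> Y;
  bap_proper :: Proper (@beq X ==> @beq Y) bap
}.

Definition Rset (R : ConstructiveReals) : bset :=
  {| carrier := CRcarrier R; beq := CReq R; beq_equiv := CReq_rel |}.

Definition prodset (X Y : bset) : bset.
Proof.
  refine {| carrier := (X * Y)%type;
            beq := fun p q => fst p =b fst q /\ snd p =b snd q |}.
  split.
  - intros p; split; reflexivity.
  - intros p q [h1 h2]; split; symmetry; assumption.
  - intros p q r [h1 h2] [h3 h4]; split; etransitivity; eassumption.
Defined.

Definition bcomp (X Y Z : bset) (g : bfun Y Z) (f : bfun X Y) : bfun X Z.
Proof.
  refine {| bap := fun x => g (f x) |}.
  intros x y h; now rewrite h.
Defined.

Definition bconst (X Y : bset) (a : Y) : bfun X Y.
Proof.
  refine {| bap := fun _ => a |}.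
  intros x y h; reflexivity.
Defined.

Definition bpr1 (X Y : bset) : bfun (prodset X Y) X.
Proof.
  refine {| bap := fun p : prodset X Y => fst p |}.
  intros p q h; exact (proj1 h).
Defined.

Definition bpr2 (X Y : bset) : bfun (prodset X Y) Y.
Proof.
  refine {| bap := fun p : prodset X Y => snd p |}.
  intros p q h; exact (proj2 h).
Defined.

Definition rplus (R : ConstructiveReals) (X : bset) (f g : bfun X (Rset R)) :
  bfun X (Rset R).
Proof.
  refine {| bap := (fun x => CRplus R (f x) (g x)) : X -> Rset R |}.
  intros x y h; apply CRplus_morph; [exact (bap_proper f h) | exact (bap_proper g h)].
Defined.

Definition Bic (R : ConstructiveReals) (phi : bfun (Rset R) (Rset R)) : Prop :=
  forall n : nat, (1 <= n)%nat ->
  forall eps : CRcarrier R, CRltProp R 0 eps ->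
  exists delta : CRcarrier R, CRltProp R 0 delta /\
    forall x y : CRcarrier R,
      - CR_of_Q R (inject_Z (Z.of_nat n)) <= x <= CR_of_Q R (inject_Z (Z.of_nat n)) ->
      - CR_of_Q R (inject_Z (Z.of_nat n)) <= y <= CR_of_Q R (inject_Z (Z.of_nat n)) ->
      CRabs R (x - y) <= delta -> CRabs R (phi x - phi y) <= eps.

Record bishop_topology (R : ConstructiveReals) (X : bset)
    (F : bfun X (Rset R) -> Prop) : Prop := {
  bs_inhabited : inhabited X;
  bs_ext : forall f g : bfun X (Rset R),
    F f -> (forall x : X, f x == g x) -> F g;
  bs_const : forall a : CRcarrier R, F (bconst X (a : Rset R));
  bs_plus : forall f g : bfun X (Rset R), F f -> F g -> F (rplus f g);
  bs_comp : forall (f : bfun X (Rset R)) (phi : bfun (Rset R) (Rset R)),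
    F f -> Bic phi -> F (bcomp phi f);
  bs_approx : forall f : bfun X (Rset R),
    (forall eps : CRcarrier R, CRltProp R 0 eps ->
       exists g : bfun X (Rset R), F g /\ forall x : X, CRabs R (g x - f x) <= eps) ->
    F f
}.

Inductive least_topology (R : ConstructiveReals) (X : bset)
    (F0 : bfun X (Rset R) -> Prop) : bfun X (Rset R) -> Prop :=
| lt_base : forall f : bfun X (Rset R), F0 f -> least_topology F0 f
| lt_ext : forall f g : bfun X (Rset R),
    least_topology F0 f -> (forall x : X, f x == g x) -> least_topology F0 g
| lt_const : forall a : CRcarrier R, least_topology F0 (bconst X (a : Rset R))
| lt_plus : forall f g : bfun X (Rset R),
    least_topology F0 f -> least_topology F0 g -> least_topology F0 (rplus f g)
| lt_comp : forall (f : bfun X (Rset R)) (phi : bfun (Rset R) (Rset R)),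
    least_topology F0 f -> Bic phi -> least_topology F0 (bcomp phi f)
| lt_approx : forall f : bfun X (Rset R),
    (forall eps : CRcarrier R, CRltProp R 0 eps ->
       exists g : bfun X (Rset R),
         least_topology F0 g /\ forall x : X, CRabs R (g x - f x) <= eps) ->
    least_topology F0 f.

Lemma least_topology_bishop (R : ConstructiveReals) (X : bset)
    (F0 : bfun X (Rset R) -> Prop) :
  inhabited X -> bishop_topology (least_topology F0).
Proof.
  intros hX; split.
  - exact hX.
  - intros f g; apply lt_ext.
  - apply lt_const.
  - intros f g; apply lt_plus.
  - intros f phi; apply lt_comp.
  - apply lt_approx.
Qed.

(* The induction principle generated for [least_topology] gives no hypothesis
   for the [g] in [lt_approx]; this lemma does. *)
Lemma least_topology_least (R : ConstructiveReals) (X : bset)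
    (F0 F : bfun X (Rset R) -> Prop) :
  bishop_topology F -> (forall f : bfun X (Rset R), F0 f -> F f) ->
  forall f : bfun X (Rset R), least_topology F0 f -> F f.
Proof.
  intros hF h0.
  fix IH 2.
  intros f hf; destruct hf as [f h | f g hf e | a | f g hf hg | f phi hf hphi | f h].
  - exact (h0 f h).
  - exact (bs_ext hF (IH f hf) e).
  - exact (bs_const hF a).
  - exact (bs_plus hF (IH f hf) (IH g hg)).
  - exact (bs_comp hF (IH f hf) hphi).
  - apply (bs_approx hF); intros eps heps.
    destruct (h eps heps) as [g [hg hgf]].
    exists g; split; [exact (IH g hg) | exact hgf].
Qed.

Inductive product_base (R : ConstructiveReals) (X Y : bset)
    (F : bfun X (Rset R) -> Prop) (G : bfun Y (Rset R) -> Prop) :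
    bfun (prodset X Y) (Rset R) -> Prop :=
| pb_fst : forall f : bfun X (Rset R), F f -> product_base F G (bcomp f (bpr1 X Y))
| pb_snd : forall g : bfun Y (Rset R), G g -> product_base F G (bcomp g (bpr2 X Y)).

Definition product_topology (R : ConstructiveReals) (X Y : bset)
    (F : bfun X (Rset R) -> Prop) (G : bfun Y (Rset R) -> Prop) :
    bfun (prodset X Y) (Rset R) -> Prop :=
  least_topology (product_base F G).

Definition bishop_morphism (R : ConstructiveReals) (X Y : bset)
    (F : bfun X (Rset R) -> Prop) (G : bfun Y (Rset R) -> Prop) (h : bfun X Y) : Prop :=
  forall g : bfun Y (Rset R), G g -> F (bcomp g h).

Record bgroup : Type := Bgroup {
  gset :> bset;
  gplus : bfun (prodset gset gset) gset;
  gzero : gset;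
  gopp : bfun gset gset;
  gplus_assoc : forall x y z : gset,
    gplus (x, gplus (y, z)) =b gplus (gplus (x, y), z);
  gplus_0_l : forall x : gset, gplus (gzero, x) =b x;
  gplus_0_r : forall x : gset, gplus (x, gzero) =b x;
  gplus_opp_l : forall x : gset, gplus (gopp x, x) =b gzero;
  gplus_opp_r : forall x : gset, gplus (x, gopp x) =b gzero
}.

Declare Scope bgroup_scope.
Delimit Scope bgroup_scope with bgroup.
Notation "x + y" := (gplus _ (x, y)) : bgroup_scope.
Notation "- x" := (gopp _ x) : bgroup_scope.
Notation "x - y" := (gplus _ (x, gopp _ y)) : bgroup_scope.
Notation "0" := (gzero _) : bgroup_scope.

Record bishop_topological_group (R : ConstructiveReals) (X : bgroup)
    (F : bfun X (Rset R) -> Prop) : Prop := {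
  btg_topology : bishop_topology F;
  btg_plus : bishop_morphism (product_topology F F) F (gplus X);
  btg_opp : bishop_morphism F F (gopp X)
}.

Definition extensional (X : bset) (C : X -> Prop) : Prop :=
  forall x y : X, x =b y -> C x -> C y.

Definition closure (R : ConstructiveReals) (X : bset)
    (F : bfun X (Rset R) -> Prop) (C : X -> Prop) (x : X) : Prop :=
  forall f : bfun X (Rset R), F f -> CRltProp R 0 (f x) ->
  exists c : X, C c /\ CRltProp R 0 (f c).

Definition closed (R : ConstructiveReals) (X : bset)
    (F : bfun X (Rset R) -> Prop) (C : X -> Prop) : Prop :=
  forall x : X, closure F C x -> C x.

Definition separating (R : ConstructiveReals) (X : bset)
    (F : bfun X (Rset R) -> Prop) : Prop :=
  forall x y : X, (forall f : bfun X (Rset R), F f -> f x == f y) -> x =b y.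

Definition normalizer (X : bgroup) (H : X -> Prop) (x : X) : Prop :=
  forall v : X, H v -> H (v + x - v)%bgroup.

Definition center (X : bgroup) (H : X -> Prop) (x : X) : Prop :=
  forall v : X, H v -> (x + v - x - v)%bgroup =b 0%bgroup.

(* Main.v *)
Require Import Defs.
From Stdlib Require Import Morphisms.
From Stdlib Require Import ConstructiveReals ConstructiveAbs.

(** Both sets are cut out by conditions on maps [X -> X] that are Bishop
    morphisms: for fixed [v], the conjugation [x |-> v + x - v] and the
    commutator [x |-> x + v - x - v].  They are morphisms because they are
    obtained from the identity, constants, [+] and [-], and because two morphisms
    into the factors of a product pair up to a morphism into the product
    ([morphism_pair]).

    A morphism [h] maps the closure of [C] into the closure of any set containing
    the image of [C] ([closure_morphism]).  For (i), conjugation by [v] in [H]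
    sends the normalizer into [H], hence its closure into the closure of [H],
    which is [H].  For (ii), the commutator with [v] sends the center to [0],
    hence its closure into the closure of the points equal to [0].  In a
    separating topology such a set of points is closed ([closed_point]): if [f]
    is in the topology, so is [|f - f 0|], which vanishes at [0] and so cannot be
    positive at a point of the closure; this means that [f] takes the value
    [f 0] there.  Since on the reals [x <= y] is the negation of [y < x], the
    argument is constructive. *)

Local Open Scope ConstructiveReals.

Definition bid (X : bset) : bfun X X :=
  {| bap := fun x => x; bap_proper := fun x y h => h |}.

Definition bpair (X Y Z : bset) (h : bfun Z X) (k : bfun Z Y) :
  bfun Z (prodset X Y).
Proof.
  refine {| bap := (fun z => (h z, k z)) : Z -> prodset X Y |}.
  intros z w e; split; [exact (bap_proper h e) | exact (bap_proper k e)].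
Defined.

(** The final topology of a map; it turns the universal property of a least
    topology into a statement about morphisms. *)
Lemma final_topology (R : ConstructiveReals) (X Y : bset)
    (F : bfun X (Rset R) -> Prop) (HF : bishop_topology F) (h : bfun X Y) :
  bishop_topology (fun g : bfun Y (Rset R) => F (bcomp g h)).
Proof.
  split.
  - destruct (bs_inhabited HF) as [x]; exact (inhabits (h x)).
  - intros f g hf e; apply (bs_ext HF hf); intros x; apply e.
  - intros a; apply (bs_ext HF (bs_const HF a)); intros x; reflexivity.
  - intros f g hf hg; apply (bs_ext HF (bs_plus HF hf hg)); intros x; reflexivity.
  - intros f phi hf hphi; apply (bs_ext HF (bs_comp HF hf hphi)); intros x; reflexivity.
  - intros f hf; apply (bs_approx HF); intros eps heps.
    destruct (hf eps heps) as [g [hg hgf]].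
    exists (bcomp g h); split; [exact hg | intros x; apply hgf].
Qed.

Section MorphismConstructions.

Variable R : ConstructiveReals.
Variables (Z : bset) (K : bfun Z (Rset R) -> Prop) (HK : bishop_topology K).

Lemma morphism_id : bishop_morphism K K (bid Z).
Proof.
  intros g hg; apply (bs_ext HK hg); intros z; reflexivity.
Qed.

Lemma morphism_const (X : bset) (F : bfun X (Rset R) -> Prop) (a : X) :
  bishop_morphism K F (bconst Z a).
Proof.
  intros g _; apply (bs_ext HK (bs_const HK (g a))); intros z; reflexivity.
Qed.

Lemma morphism_comp (X Y : bset) (F : bfun X (Rset R) -> Prop)
    (G : bfun Y (Rset R) -> Prop) (h : bfun Z X) (k : bfun X Y) :
  bishop_morphism K F h -> bishop_morphism F G k ->
  bishop_morphism K G (bcomp k h).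
Proof.
  intros hh hk g hg; apply (bs_ext HK (hh _ (hk g hg))); intros z; reflexivity.
Qed.

(** The final topology of the pairing contains both kinds of generators of the
    product topology, hence all of it. *)
Lemma morphism_pair (X Y : bset) (F : bfun X (Rset R) -> Prop)
    (G : bfun Y (Rset R) -> Prop) (h : bfun Z X) (k : bfun Z Y) :
  bishop_morphism K F h -> bishop_morphism K G k ->
  bishop_morphism K (product_topology F G) (bpair X Y Z h k).
Proof.
  intros hh hk.
  refine (least_topology_least (final_topology R _ _ K HK (bpair X Y Z h k)) _).
  intros f [g hg | g hg].
  - apply (bs_ext HK (hh g hg)); intros z; reflexivity.
  - apply (bs_ext HK (hk g hg)); intros z; reflexivity.
Qed.

Lemma morphism_add (X : bgroup) (F : bfun X (Rset R) -> Prop)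
    (HF : bishop_topological_group F) (h k : bfun Z X) :
  bishop_morphism K F h -> bishop_morphism K F k ->
  bishop_morphism K F (bcomp (gplus X) (bpair X X Z h k)).
Proof.
  intros hh hk.
  exact (morphism_comp _ _ _ _ _ _ (morphism_pair _ _ _ _ _ _ hh hk) (btg_plus HF)).
Qed.

End MorphismConstructions.

Definition conjugation (X : bgroup) (v : X) : bfun X X :=
  bcomp (gplus X) (bpair X X X
    (bcomp (gplus X) (bpair X X X (bconst X v) (bid X)))
    (bconst X (gopp X v))).

Definition commutator (X : bgroup) (v : X) : bfun X X :=
  bcomp (gplus X) (bpair X X X
    (bcomp (gplus X) (bpair X X X
      (bcomp (gplus X) (bpair X X X (bid X) (bconst X v)))
      (gopp X)))
    (bconst X (gopp X v))).

Lemma conjugation_morphism (R : ConstructiveReals) (X : bgroup)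
    (F : bfun X (Rset R) -> Prop) (HF : bishop_topological_group F) (v : X) :
  bishop_morphism F F (conjugation X v).
Proof.
  pose proof (btg_topology HF) as HT.
  repeat (apply morphism_add; auto using morphism_const, morphism_id).
Qed.

Lemma commutator_morphism (R : ConstructiveReals) (X : bgroup)
    (F : bfun X (Rset R) -> Prop) (HF : bishop_topological_group F) (v : X) :
  bishop_morphism F F (commutator X v).
Proof.
  pose proof (btg_topology HF) as HT; pose proof (btg_opp HF) as Hopp.
  repeat (apply morphism_add; auto using morphism_const, morphism_id).
Qed.

Lemma closure_morphism (R : ConstructiveReals) (X Y : bset)
    (F : bfun X (Rset R) -> Prop) (G : bfun Y (Rset R) -> Prop) (h : bfun X Y)
    (C : X -> Prop) (D : Y -> Prop) :
  bishop_morphism F G h -> (forall c : X, C c -> D (h c)) ->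
  forall x : X, closure F C x -> closure G D (h x).
Proof.
  intros hh hCD x hx g hg hpos.
  destruct (hx (bcomp g h) (hh g hg) hpos) as [c [hc hcpos]].
  exists (h c); split; [exact (hCD c hc) | exact hcpos].
Qed.

Definition rdist (R : ConstructiveReals) (a : CRcarrier R) :
  bfun (Rset R) (Rset R).
Proof.
  refine {| bap := (fun y => CRabs R (y - a)) : Rset R -> Rset R |}.
  intros y z e; apply CRabs_morph, CRplus_morph; [exact e | reflexivity].
Defined.

(** The distance to a point is nonexpansive, so [eps] serves as its own modulus
    of continuity. *)
Lemma rdist_Bic (R : ConstructiveReals) (a : CRcarrier R) : Bic (rdist R a).
Proof.
  intros n _ eps heps; exists eps; split; [exact heps |].
  intros y z _ _ hyz; cbn.
  apply (CRle_trans _ (CRabs R ((y - a) - (z - a)))).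
  - apply CRabs_triang_inv2.
  - assert (e : (y - a) - (z - a) == y - z).
    { unfold CRminus; rewrite CRopp_plus_distr, CRopp_involutive.
      rewrite (CRplus_comm (- z) a), CRplus_assoc, <- (CRplus_assoc (- a) a).
      now rewrite CRplus_opp_l, CRplus_0_l. }
    now rewrite e.
Qed.

(** A function [f] of the topology that differed from [f a] at a point of the
    closure would make [|f - f a|] positive there, hence positive at a point
    equal to [a], where it vanishes. *)
Lemma closed_point (R : ConstructiveReals) (X : bset)
    (F : bfun X (Rset R) -> Prop) (HF : bishop_topology F) (a : X) :
  separating F -> closed F (fun x => beq x a).
Proof.
  intros hsep x hx; apply hsep; intros f hf.
  assert (hle : CRabs R (f x - f a) <= 0).
  { intros hlt.
    destruct (hx (bcomp (rdist R (f a)) f) (bs_comp HF hf (rdist_Bic R (f a)))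
                 (CRltForget R _ _ hlt)) as [c [hc hpos]].
    (* [CRle] is a negation in [Set], so the propositional inequality has to be
       turned back into the informative one that it refutes. *)
    enough (h0 : CRabs R (f c - f a) <= 0) by exact (h0 (CRltEpsilon R _ _ hpos)).
    assert (e : f c - f a == 0).
    { rewrite <- (CRplus_opp_r (f a)).
      apply CRplus_morph; [exact (bap_proper f hc) | reflexivity]. }
    rewrite e, CRabs_right; apply CRle_refl. }
  assert (h0 : f x - f a == 0).
  { split; cycle 1.
    - apply (CRle_trans _ (CRabs R (f x - f a)) _); [apply CRle_abs | exact hle].
    - rewrite <- (CRopp_involutive (f x - f a)), <- CRopp_0.
      apply CRopp_ge_le_contravar.
      apply (CRle_trans _ (CRabs R (- (f x - f a))) _); [apply CRle_abs |].
      now rewrite CRabs_opp. }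
  apply (CRplus_eq_reg_r (- f a)); rewrite CRplus_opp_r; exact h0.
Qed.

Theorem theorem5p7 (R : ConstructiveReals) (X : bgroup)
    (F : bfun X (Rset R) -> Prop) (HF : bishop_topological_group F)
    (H : X -> Prop) (Hext : extensional H) :
  (closed F H -> closed F (normalizer H)) /\
  (separating F -> closed F (center H)).
Proof.
  split.
  - intros hH x hx v hv; apply hH.
    apply (closure_morphism R X X F F (conjugation X v) (normalizer H) H);
      [now apply conjugation_morphism | | exact hx].
    intros c hc; exact (hc v hv).
  - intros hsep x hx v hv.
    apply (closed_point R X F (btg_topology HF) (gzero X) hsep).
    apply (closure_morphism R X X F F (commutator X v) (center H));
      [now apply commutator_morphism | | exact hx].
    intros c hc; exact (hc v hv).
Qed.
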